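(* Let $(P,\le)$ be a finite partially ordered set and let $I$ be an irreducible upper set of $P$. Then $\chi_I$ is a prime element of the monoid $\mathrm{M}(P)$ if and only if both of the following hold: 1. $\chi_I\not\le_{\mathrm{M}(P)}\chi_{G\cup H}$ and $\chi_I\not\le_{\mathrm{M}(P)}\chi_{G\cap H}$ for all irreducible upper sets $G,H$ with $G\ne I$ and $H\ne I$; 2. for every irreducible upper set $J\ne I$, $\{I,J\}$ is a near-chain.
   Context: $\mathrm{M}(P)$ is the monoid under pointwise addition of monotone functions $P\to\mathbb{N}$. An upper set is an upward-closed subset; an irreducible upper set is a nonempty upper set that is not the union of two disjoint nonempty upper sets; $\chi_U$ is the indicator function of $U$. $f\le_{\mathrm{M}(P)}g$ means $g=f+h$ for some $h\in\mathrm{M}(P)$. An element $a$ is prime if $a\le_{\mathrm{M}(P)}b+c$ implies $a\le_{\mathrm{M}(P)}b$ or $a\le_{\mathrm{M}(P)}c$. $\{I,J\}$ is a near-chain if $I\subseteq J$, $J\subseteq I$, or $I\cap J=\emptyset$. *)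

(* Defs.v *)
From HB Require Import structures.
From mathcomp Require Import all_boot all_order all_algebra.

Set Implicit Arguments.
Unset Strict Implicit.
Unset Printing Implicit Defensive.

Import Order.TTheory GRing.Theory.
Local Open Scope ring_scope.

(* The algebraic preorder and prime elements of a commutative monoid. *)
Definition alg_le (M : nmodType) (a b : M) : Prop := exists c : M, b = a + c.

Definition prime_elt (M : nmodType) (a : M) : Prop :=
  forall b c : M, alg_le a (b + c) -> alg_le a b \/ alg_le a c.

Definition monotone_pred d (P : finPOrderType d) : {pred {ffun P -> nat}} :=
  fun f => [forall x, forall y, (x <= y)%O ==> (f x <= f y)%N].
Arguments monotone_pred {d} P _.

Lemma monotone_predP d (P : finPOrderType d) (f : {ffun P -> nat}) :
  reflect (forall x y : P, (x <= y)%O -> (f x <= f y)%N) (f \in monotone_pred P).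
Proof.
apply: (iffP forallP) => [h x y xy | h x].
  by have /forallP/(_ y)/implyP := h x; apply.
by apply/forallP => y; apply/implyP; apply: h.
Qed.

Fact monotone_nmod_closed d (P : finPOrderType d) :
  Algebra.nmod_closed (monotone_pred P).
Proof.
split=> [|f g /monotone_predP hf /monotone_predP hg];
  apply/monotone_predP => x y xy; rewrite !ffunE //.
by apply: leq_add; [apply: hf | apply: hg].
Qed.

(* M(P); its [nmodType] structure is inherited from {ffun P -> nat}, so that
   addition is pointwise. *)
Record monofun d (P : finPOrderType d) := Monofun {
  monofun_val :> {ffun P -> nat};
  _ : monofun_val \in monotone_pred P
}.

HB.instance Definition _ d (P : finPOrderType d) :=
  [isSub for @monofun_val d P].
HB.instance Definition _ d (P : finPOrderType d) :=
  [Choice of monofun P by <:].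
HB.instance Definition _ d (P : finPOrderType d) :=
  GRing.SubChoice_isSubNmodule.Build _ _ (monofun P) (@monotone_nmod_closed d P).

Lemma monofunD d (P : finPOrderType d) (f g : monofun P) (x : P) :
  (f + g) x = (f x + g x)%N.
Proof. by rewrite -[monofun_val (f + g)]/(val (f + g)) raddfD ffunE. Qed.

Definition upper_set d (P : finPOrderType d) (U : {set P}) : bool :=
  [forall x, forall y, (x \in U) && (x <= y)%O ==> (y \in U)].

Lemma upper_setP d (P : finPOrderType d) (U : {set P}) :
  reflect (forall x y : P, x \in U -> (x <= y)%O -> y \in U) (upper_set U).
Proof.
apply: (iffP forallP) => [h x y xU xy | h x].
  by have /forallP/(_ y)/implyP := h x; apply; rewrite xU.
by apply/forallP => y; apply/implyP => /andP[]; apply: h.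
Qed.

Record upset d (P : finPOrderType d) := Upset {
  upset_val :> {set P};
  upset_valP : upper_set upset_val
}.

HB.instance Definition _ d (P : finPOrderType d) := [isSub for @upset_val d P].
HB.instance Definition _ d (P : finPOrderType d) := [Finite of upset P by <:].

Section UpsetOps.
Context d (P : finPOrderType d).
Implicit Types U V : upset P.

Fact upsetU_proof U V : upper_set (U :|: V).
Proof.
apply/upper_setP => x y; rewrite !inE => /orP[] xU xy; apply/orP.
  by left; apply: (upper_setP _ (upset_valP U) x).
by right; apply: (upper_setP _ (upset_valP V) x).
Qed.
Definition upsetU U V : upset P := Upset (upsetU_proof U V).

Fact upsetI_proof U V : upper_set (U :&: V).
Proof.
apply/upper_setP => x y; rewrite !inE => /andP[xU xV] xy.
by rewrite (upper_setP _ (upset_valP U) x) // (upper_setP _ (upset_valP V) x).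
Qed.
Definition upsetI U V : upset P := Upset (upsetI_proof U V).

Fact chi_proof U : [ffun x => (x \in (U : {set P}) : nat)] \in monotone_pred P.
Proof.
apply/monotone_predP => x y xy; rewrite !ffunE; case: (boolP (x \in _)) => // xU.
by rewrite (upper_setP _ (upset_valP U) x).
Qed.
Definition chi U : monofun P := Monofun (chi_proof U).

Definition irreducible_upset U : Prop :=
  (U : {set P}) <> set0 /\
  ~ exists V W : upset P,
      [/\ (V : {set P}) <> set0, (W : {set P}) <> set0,
          (V : {set P}) :&: W = set0 & (U : {set P}) = V :|: W].

End UpsetOps.

Definition near_chain (T : finType) (A B : {set T}) : Prop :=
  [\/ A \subset B, B \subset A | A :&: B = set0].

(* Main.v *)
Require Import Defs.
From HB Require Import structures.
From mathcomp Require Import all_boot all_order all_algebra.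

(**
  One has [chi I <= f] iff [f] is positive on [I] and increases strictly along
  every relation [x <= y] that enters [I].

  If [chi I] is prime, apply primality to
  [chi G + chi H = chi (G :|: H) + chi (G :&: H)], and to the same identity for
  the pair [I], [J] when that pair is not a near-chain.

  Conversely, a largest irreducible upper set [C] strictly inside [I] together
  with a principal upper set meeting [C] would cover [I], so (1) for unions
  forces [I] to be the principal upper set of some [m]. By (2), every relation
  entering [I] starts below [m], so [chi I <= f] only says that [f m] is positive
  and [f x < f m] for all [x < m]. If this fails for [b] at [x] and for [c] at
  [x'], then (1) for the intersection of the principal upper sets of [x] and [x']
  gives some [z < m] above both, where [b + c] takes the same value as at [m].
*)

Set Implicit Arguments.
Unset Strict Implicit.
Unset Printing Implicit Defensive.

Import Order.TTheory GRing.Theory.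

Section PrimeIndicators.
Context (d : Order.disp_t) (P : finPOrderType d).
Implicit Types (U V G H I J : upset P) (f b c : monofun P) (x y z m : P).

Lemma upsetW U x y : x \in (U : {set P}) -> (x <= y)%O -> y \in (U : {set P}).
Proof. exact: upper_setP (upset_valP U) x y. Qed.

Lemma monofun_le f x y : (x <= y)%O -> f x <= f y.
Proof. exact: monotone_predP (valP f) x y. Qed.

Lemma chiE U x : chi U x = (x \in (U : {set P})).
Proof. by rewrite /= ffunE. Qed.

Lemma monofun_eq f b : (forall x, f x = b x) -> f = b.
Proof. by move=> fb; apply: val_inj; apply/ffunP. Qed.

(** * Irreducible upper sets *)

Fact principal_proof x : upper_set [set y : P | (x <= y)%O].
Proof. by apply/upper_setP => y z; rewrite !inE; apply: le_trans. Qed.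
Definition principal x : upset P := Upset (principal_proof x).

Lemma in_principal x y : (y \in (principal x : {set P})) = (x <= y)%O.
Proof. by rewrite inE. Qed.

Lemma principal_sub U x : x \in (U : {set P}) -> principal x \subset U.
Proof. by move=> xU; apply/subsetP => y; rewrite in_principal; apply: upsetW. Qed.

(** [U :&: V] and [U :\: V] are disjoint upper sets covering [U], so one of them is empty. *)
Lemma irreducible_dichotomy U V :
    irreducible_upset U -> upper_set (U :\: V) ->
  (U : {set P}) :&: V = set0 \/ (U : {set P}) \subset V.
Proof.
move=> [_ irrU] upUV; have [->|UV0] := eqVneq ((U : {set P}) :&: V) set0.
  by left.
right; rewrite -setD_eq0; apply/negP => /negP UD0.
case: irrU; exists (upsetI U V), (Upset upUV).
split; [exact/eqP | exact/eqP | | by rewrite setID].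
by apply/setP => x; rewrite !inE; case: (x \in _) => //=; case: (x \in _).
Qed.

(** A splitting of [U] into [V] and [W] refutes the hypothesis at [V], since [U :\: V] is then [W];
    the point [x] makes [U] nonempty. *)
Lemma irreducible_intro U x :
    x \in (U : {set P}) ->
    (forall V, upper_set (U :\: V) -> (U : {set P}) :&: V = set0 \/ U \subset V) ->
  irreducible_upset U.
Proof.
move=> xU irrU; split=> [U0|]; first by rewrite U0 inE in xU.
move=> [V [W [/eqP V0 /eqP W0 VW0 UVW]]].
have UDV : U :\: V = W.
  apply/setP => y; rewrite inE UVW inE; case: (boolP (y \in (V : {set P}))) => //= yV.
  apply/esym/negP => yW.
  by have := in_set0 y; rewrite -VW0 inE yV yW.
have [|/eqP|] := irrU V; first by rewrite UDV upset_valP.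
  by rewrite UVW setUK (negPf V0).
by rewrite -setD_eq0 UDV (negPf W0).
Qed.

Lemma irreducible_principal x : irreducible_upset (principal x).
Proof.
have xx : x \in (principal x : {set P}) by rewrite in_principal.
apply: (irreducible_intro xx) => V /upper_setP upD.
have [xV|xV] := boolP (x \in (V : {set P})); first by right; apply: principal_sub.
left; apply/setP => y; rewrite [RHS]inE [LHS]inE in_principal; apply/andP => -[xy yV].
have: y \in principal x :\: V by apply: (upD x); rewrite // inE xV.
by rewrite inE yV.
Qed.

(** A splitting of the union restricts to [G] and to [H], each of which lies on one side; the common
    point [z] forces the same side for both. *)
Lemma irreducibleU G H z :
    irreducible_upset G -> irreducible_upset H ->
    z \in (G : {set P}) -> z \in (H : {set P}) ->
  irreducible_upset (upsetU G H).
Proof.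
move=> irrG irrH zG zH.
have zU : z \in (upsetU G H : {set P}) by rewrite inE zG.
apply: (irreducible_intro zU) => V /upper_setP upD.
have upX (K : upset P) : K \subset upsetU G H -> upper_set (K :\: V).
  move=> /subsetP sK; apply/upper_setP => x y; rewrite !in_setD => /andP[xV xK] xy.
  rewrite (upsetW xK xy) andbT.
  have: y \in upsetU G H :\: V by apply: (upD x); rewrite // in_setD xV; apply: sK.
  by rewrite in_setD => /andP[].
have [GV0|GV] := irreducible_dichotomy irrG (upX G (subsetUl _ _));
have [HV0|HV] := irreducible_dichotomy irrH (upX H (subsetUr _ _)).
- by left; rewrite setIUl GV0 HV0 setU0.
- by have := in_set0 z; rewrite -GV0 inE zG (subsetP HV).
- by have := in_set0 z; rewrite -HV0 inE zH (subsetP GV).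
- by right; rewrite subUset GV.
Qed.

(** * Elements above an indicator *)

Lemma alg_le_chiP I f :
  alg_le (chi I) f <->
    (forall y, y \in (I : {set P}) -> 0 < f y) /\
    (forall x y, x \notin (I : {set P}) -> y \in (I : {set P}) ->
       (x <= y)%O -> f x < f y).
Proof.
split=> [[c ->]|[fpos flt]].
  split=> [y yI|x y xI yI xy]; rewrite !monofunD !chiE ?yI //.
  by rewrite (negPf xI) add0n add1n ltnS monofun_le.
(* Positivity of [f] on [I] prevents truncation in this subtraction; the strict increase makes up
   for the unit lost on entering [I]. *)
have mono : [ffun x => f x - chi I x] \in monotone_pred P.
  apply/monotone_predP => x y xy; rewrite !ffunE.
  case: (boolP (x \in _)) => xI; first by rewrite (upsetW xI xy) leq_sub2r // monofun_le.
  case: (boolP (y \in _)) => yI; rewrite !subn0 ?monofun_le //.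
  by rewrite subn1 -ltnS prednK ?fpos //; apply: flt.
exists (Monofun mono); apply: monofun_eq => x; rewrite monofunD [X in _ = _ + X]ffunE.
by rewrite subnKC // chiE; case: (boolP (x \in _)) => // /fpos.
Qed.

(** A relation from [U :\: I] into [I] is exactly one that enters [I] while [chi U] stays at 1. *)
Lemma alg_le_chi_chiP I U :
  alg_le (chi I) (chi U) <-> I \subset U /\ upper_set (U :\: I).
Proof.
split=> [/alg_le_chiP[cpos clt]|[/subsetP IU /upper_setP upD]].
  split; first by apply/subsetP => y /cpos; rewrite chiE lt0b.
  apply/upper_setP => x y; rewrite !inE => /andP[xI xU] xy.
  rewrite (upsetW xU xy) andbT; apply/negP => yI.
  by have := clt x y xI yI xy; rewrite !chiE xU (upsetW xU xy).
apply/alg_le_chiP; split=> [y /IU|x y xI yI xy]; rewrite !chiE ?lt0b // (IU _ yI).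
rewrite ltnS leqn0 eqb0; apply/negP => xU.
by have := upD x y; rewrite !inE xI xU yI => /(_ isT xy).
Qed.

Lemma irreducible_alg_le_eq I G :
    irreducible_upset I -> irreducible_upset G ->
  alg_le (chi I) (chi G) -> G = I.
Proof.
move=> [/eqP I0 _] irrG /alg_le_chi_chiP[IG /(irreducible_dichotomy irrG)[GI0|GI]].
  by move: I0; rewrite -GI0 (setIidPr IG) eqxx.
by apply: val_inj; apply/eqP; rewrite eqEsubset GI IG.
Qed.

(** * Consequences of primality *)

Lemma chiUI G H : (chi (upsetU G H) + chi (upsetI G H) = chi G + chi H)%R.
Proof.
apply: monofun_eq => x; rewrite !monofunD !chiE !inE.
by case: (x \in _); case: (x \in _).
Qed.

Lemma alg_leDl (M : nmodType) (a b : M) : alg_le a (a + b)%R.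
Proof. by exists b. Qed.

Lemma alg_le_addr (M : nmodType) (a b c : M) : alg_le a b -> alg_le a (b + c)%R.
Proof. by move=> [e ->]; exists (e + c)%R; rewrite addrA. Qed.

Lemma prime_chi_near_chain I J :
    prime_elt (chi I) -> irreducible_upset J -> near_chain I J.
Proof.
move=> prI irrJ.
have := alg_leDl (chi I) (chi J); rewrite -chiUI => /prI[]/alg_le_chi_chiP[].
  (* Removing [I] from the union leaves [J :\: I], which is therefore upper. *)
  rewrite setDUl setDv set0U => _ /(irreducible_dichotomy irrJ)[JI0|JI].
    by constructor 3; rewrite setIC.
  by constructor 2.
by rewrite subsetI => /andP[_ IJ] _; constructor 1.
Qed.

Lemma prime_chi_irreducible I G H :
    irreducible_upset I -> prime_elt (chi I) ->
    irreducible_upset G -> irreducible_upset H ->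
  alg_le (chi I) (chi G + chi H)%R -> G = I \/ H = I.
Proof.
move=> irrI prI irrG irrH /prI[] le_I; [left|right];
  exact: irreducible_alg_le_eq le_I.
Qed.

(** * Sufficiency of the two conditions *)

Lemma irreducible_union_principal I :
    irreducible_upset I ->
    (forall G H, irreducible_upset G -> irreducible_upset H ->
       G <> I -> H <> I -> upsetU G H <> I) ->
  exists m, I = principal m.
Proof.
move=> irrI noU; have [/eqP/set0Pn[v vI] _] := irrI.
have [/existsP[m /eqP ->]|/existsPn npI] := boolP [exists m, I == principal m].
  by exists m.
(* Instead of choosing a largest [C], enlarge it step by step; taking [n] to be the size of [I] is
   then absurd. *)
have propC n : exists C, [/\ irreducible_upset C, C \proper I & n <= #|C : {set P}|].
  elim: n => [|n [C [irrC prC nC]]].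
    exists (principal v); split=> //; first exact: irreducible_principal.
    rewrite properEneq principal_sub // andbT.
    by apply: contraNneq (npI v) => /val_inj ->.
  have [CI [u uI uC]] := properP prC.
  (* Otherwise [I :\: C] would be upper, and irreducibility of [I] would make [C] empty or all of
     [I]. *)
  have [w [wI wC]] : exists w, [/\ w \in (I : {set P}), w \notin (C : {set P})
      & exists2 z, (w <= z)%O & z \in (C : {set P})].
    have [upD|] := boolP (upper_set (I :\: C)).
      have [IC0|IC] := irreducible_dichotomy irrI upD; last first.
        by rewrite (subsetP IC) in uC.
      by have [[]] := irrC; rewrite -IC0 (setIidPr CI).
    move=> /forallPn[w /forallPn[z]]; rewrite negb_imply !inE negb_and negbK.
    case/andP=> /andP[/andP[wC wI] wz]; rewrite (upsetW wI wz) orbF => zC.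
    by exists w; split=> //; exists z.
  move=> [z wz zC]; exists (upsetU C (principal w)).
  have zw : z \in (principal w : {set P}) by rewrite in_principal.
  have irrw := irreducible_principal w.
  split; first exact: irreducibleU zC zw.
    rewrite properEneq [X in _ && X]subUset CI [X in _ && X]principal_sub // andbT.
    apply/eqP => /val_inj; apply: noU => // [CI'|wI'].
      by rewrite CI' uI in uC.
    by have := npI w; rewrite wI' eqxx.
  apply: leq_ltn_trans nC _; apply: proper_card; apply/properP; split.
    exact: subsetUl.
  by exists w => //; rewrite !inE lexx orbT.
have [C [_ /proper_card CI]] := propC #|I : {set P}|.
by rewrite leqNgt CI.
Qed.

(** Compare [principal m] with [principal x]: they share [y], and [x] lies only in the second, so
    the first is contained in it. *)
Lemma near_chain_principal_le m x y :
    (forall J, irreducible_upset J -> J <> principal m ->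
       near_chain (principal m) J) ->
  ~~ (m <= x)%O -> (m <= y)%O -> (x <= y)%O -> (x < m)%O.
Proof.
move=> nc mx my xy.
have xI : x \notin (principal m : {set P}) by rewrite in_principal.
suff xm : (x <= m)%O by rewrite lt_neqAle xm andbT; apply: contraNneq mx => ->.
have [||/subsetP s|/subsetP s|I0] := nc (principal x).
- exact: irreducible_principal.
- by move=> E; rewrite -E in_principal lexx in xI.
- by have := s m; rewrite !in_principal lexx => /(_ isT).
- by have := s x; rewrite in_principal lexx (negPf xI) => /(_ isT).
- by have := in_set0 y; rewrite -I0 in_setI !in_principal my xy.
Qed.

(** The boolean criterion lets its failure be turned into a witness [x]. *)
Lemma alg_le_chi_principalP m f :
    (forall J, irreducible_upset J -> J <> principal m ->
       near_chain (principal m) J) ->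
  reflect (alg_le (chi (principal m)) f)
    ((0 < f m) && [forall x, (x < m)%O ==> (f x < f m)]).
Proof.
move=> nc; apply: (iffP andP) => [[fm0 /forallP fm]|/alg_le_chiP[fpos flt]].
  apply/alg_le_chiP; split=> [y|x y]; rewrite !in_principal => my.
    exact: leq_trans fm0 (monofun_le f my).
  move=> {}y' xy; have xm := near_chain_principal_le nc my y' xy.
  by apply: leq_trans (monofun_le f y'); have /implyP := fm x; apply.
split; first by apply: fpos; rewrite in_principal.
apply/forallP => x; apply/implyP => xm.
by apply: flt; rewrite ?in_principal ?(lt_geF xm) // ltW.
Qed.

Lemma prime_chi_principal m :
    (forall x y, (x < m)%O -> (y < m)%O ->
       ~ alg_le (chi (principal m)) (chi (upsetI (principal x) (principal y)))) ->
    (forall J, irreducible_upset J -> J <> principal m ->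
       near_chain (principal m) J) ->
  prime_elt (chi (principal m)).
Proof.
move=> noI nc b c /(alg_le_chi_principalP _ nc)/andP[].
rewrite monofunD => bc0 /forallP bc.
have {}bc x : (x < m)%O -> b x + c x < b m + c m.
  by have /implyP := bc x; rewrite !monofunD.
(* Failure means that [f] vanishes at [m] or is constant between some [x < m] and [m]. *)
have fail f : ~~ ((0 < f m) && [forall x, (x < m)%O ==> (f x < f m)]) ->
    f m = 0 \/ exists2 x, (x < m)%O & forall z, (x <= z)%O -> (z <= m)%O -> f z = f m.
  rewrite negb_and -eqn0Ngt => /orP[/eqP|/forallPn[x]]; first by left.
  rewrite negb_imply -leqNgt => /andP[xm fmx]; right; exists x => // z xz zm.
  by apply/eqP; rewrite eqn_leq monofun_le //= (leq_trans fmx) // monofun_le.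
have zero f x : f m = 0 -> (x < m)%O -> f x = 0.
  by move=> f0 /ltW/(monofun_le f); rewrite f0 leqn0 => /eqP.
have [/(alg_le_chi_principalP _ nc)|/fail fb] :=
  boolP ((0 < b m) && [forall x, (x < m)%O ==> (b x < b m)]); first by left.
have [/(alg_le_chi_principalP _ nc)|/fail fc] :=
  boolP ((0 < c m) && [forall x, (x < m)%O ==> (c x < c m)]); first by right.
exfalso.
case: fb fc => [b0|[x xm bx]] [c0|[y ym cy]].
- by rewrite b0 c0 in bc0.
- by have := bc y ym; rewrite (zero b) // b0 cy ?(ltW ym) // ltnn.
- by have := bc x xm; rewrite (zero c) // c0 bx ?(ltW xm) // ltnn.
(* The intersection contains [m] but no [z < m], since [b + c] would agree at such a [z] and at [m];
   hence its indicator lies above [chi (principal m)]. *)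
apply: (noI x y xm ym).
apply/(alg_le_chi_principalP _ nc); rewrite chiE in_setI !in_principal !ltW //.
rewrite andTb; apply/forallP => z; apply/implyP => zm; rewrite chiE in_setI !in_principal.
rewrite ltnS leqn0 eqb0; apply/andP => -[xz yz].
by have := bc z zm; rewrite bx ?cy ?(ltW zm) // ltnn.
Qed.

End PrimeIndicators.

Theorem theorem13 (d : Order.disp_t) (P : finPOrderType d) (I : upset P)
    (hI : irreducible_upset I) :
  prime_elt (chi I) <->
  (forall G H : upset P, irreducible_upset G -> irreducible_upset H ->
     G <> I -> H <> I ->
     ~ alg_le (chi I) (chi (upsetU G H)) /\
     ~ alg_le (chi I) (chi (upsetI G H))) /\
  (forall J : upset P, irreducible_upset J -> J <> I -> near_chain I J).
Proof.
split=> [prI|[noUI nc]].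
  split=> [G H irrG irrH nGI nHI|J irrJ _]; last exact: prime_chi_near_chain.
  have noGH : ~ alg_le (chi I) (chi G + chi H)%R.
    by move=> /(prime_chi_irreducible hI prI irrG irrH)[].
  rewrite -chiUI in noGH.
  split=> le_I; apply: noGH; first exact: alg_le_addr.
  by rewrite addrC; apply: alg_le_addr.
have [|m Im] := irreducible_union_principal hI.
  (* If the union were [I], condition 1 would deny that [chi I] lies below itself. *)
  move=> G H irrG irrH nGI nHI E; have [noU _] := noUI G H irrG irrH nGI nHI.
  by apply: noU; rewrite E; apply/alg_le_chi_chiP; rewrite setDv; split=> //;
    apply/upper_setP => x y; rewrite inE.
have lt_neq x : (x < m)%O -> principal x <> principal m.
  move=> xm E; have: x \in (principal m : {set P}) by rewrite -E in_principal.
  by rewrite in_principal (lt_geF xm).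
rewrite Im in noUI nc *; apply: prime_chi_principal => // x y xm ym.
by have [] := noUI _ _ (irreducible_principal x) (irreducible_principal y)
  (lt_neq x xm) (lt_neq y ym).
Qed.
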